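(* $\text{\ss}_i \geq \mathbf{cov}(\mathcal{M})$, where $\text{\ss}_i$ is the subseries number for divergence to $\pm\infty$ and $\mathbf{cov}(\mathcal{M})$ is the covering number for Baire category.
   Context: $\mathbb{N}=\{1,2,3,\dots\}$. For $A\subseteq\mathbb{N}$, the subseries $\sum_{n\in A}a_n$ is summed in increasing order of the indices. A series is conditionally convergent if it converges but not absolutely. $\text{\ss}_i$ is the smallest cardinality of a family $\mathcal{A}$ of subsets of $\mathbb{N}$ such that for every conditionally convergent series $\sum_{n\in\mathbb{N}}a_n$ of real numbers there is $A\in\mathcal{A}$ such that $\sum_{n\in A}a_n$ diverges to $+\infty$ or diverges to $-\infty$. $\mathbf{cov}(\mathcal{M})$ is the minimum cardinality of a family of meager subsets of the Cantor space $2^{\mathbb{N}}$ whose union is $2^{\mathbb{N}}$. *)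

(* Defs.v *)
From HB Require Import structures.
From mathcomp Require Import all_boot all_order all_algebra.
From mathcomp Require Import all_classical all_reals all_analysis.

Set Implicit Arguments.
Unset Strict Implicit.
Unset Printing Implicit Defensive.

Import Order.TTheory GRing.Theory Num.Theory.
Import numFieldNormedType.Exports.

Local Open Scope classical_set_scope.
Local Open Scope card_scope.
Local Open Scope ring_scope.

Definition min_card (T : Type) (P : set (set T)) : set (set T) :=
  [set A | P A /\ forall B, P B -> A #<= B].

(* The cardinals are well-ordered: take, by Zorn's lemma, a maximal set of
   choice functions on P any two of which differ at every member of P.  Its
   evaluation map is injective at every member of P, and onto at one of them. *)
Lemma min_card_nonempty (T : pointedType) (P : set (set T)) :
  P !=set0 -> min_card P !=set0.
Proof.
case=> A0 PA0.
pose Q (X : set (set T -> T)) :=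
  (forall f B, X f -> P B -> B (f B)) /\
  (forall f g B, X f -> X g -> P B -> f B = g B -> f = g).
have [|X [[Xin Xinj] Xmax]] := @Zorn_bigcup _ Q.
  move=> F FQ totF; split.
    by move=> f B [Y FY Yf] PB; exact: (FQ _ FY).1 _ _ Yf PB.
  move=> f g B [Y FY Yf] [Z FZ Zg] PB fg.
  have [YZ|ZY] := totF _ _ FY FZ.
    exact: (FQ _ FZ).2 _ _ _ (YZ _ Yf) Zg PB fg.
  exact: (FQ _ FY).2 _ _ _ Yf (ZY _ Zg) PB fg.
have [B PB surj] : exists2 B, P B & forall t, B t -> exists2 f, X f & f B = t.
  apply: contrapT => noB.
  have ex B : exists t, P B -> B t /\ forall f, X f -> f B <> t.
    have [PB|nPB] := pselect (P B); last by exists point.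
    apply: contrapT => H; apply: noB; exists B => // t Bt.
    apply: contrapT => H'; apply: H; exists t => _; split => // f Xf fBt.
    by apply: H'; exists f.
  have [h hP] := choice ex.
  have nXh : ~ X h by move=> Xh; exact: (hP _ PA0).2 Xh erefl.
  apply: (Xmax (X `|` [set h])).
    split; first exact: subsetUl.
    by move=> /(_ h) H; apply: nXh; apply: H; right.
  split.
    by move=> f B [Xf|->] PB; [exact: Xin Xf PB|have [] := hP _ PB].
  move=> f g B [Xf|->] [Xg|->] PB //.
  - by move=> e; exact: Xinj Xf Xg PB e.
  - by move=> e; case: ((hP _ PB).2 _ Xf).
  - by move=> e; case: ((hP _ PB).2 _ Xg).
exists B; split => // C PC.
have BX : B = (fun f => f B) @` X.
  by apply/seteqP; split=> [t /surj[f Xf <-]|_ [f Xf <-]]; [exists f|exact: Xin Xf PB].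
have BXc : B #= X.
  rewrite {1}BX; apply: inj_card_eq => f g; rewrite !inE => Xf Xg e.
  exact: Xinj Xf Xg PB e.
have CXc : (fun f => f C) @` X #= X.
  apply: inj_card_eq => f g; rewrite !inE => Xf Xg e.
  exact: Xinj Xf Xg PC e.
rewrite (card_le_eql BXc) -(card_le_eql CXc).
by apply: subset_card_le => _ [f Xf <-]; exact: Xin Xf PC.
Qed.

Definition conditionally_convergent (R : realType) (a : R^nat) : Prop :=
  cvgn (series a) /\ ~ cvgn [normed series a].

(* Series are indexed from 0.  The n-th partial sum of the subseries runs over
   the elements of A below n. *)
Definition subseries (R : realType) (a : R^nat) (A : set nat) : R^nat :=
  [sequence \sum_(0 <= k < n | k \in A) a k]_n.

Definition ss_i_family (R : realType) : set (set (set nat)) :=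
  [set F | forall a : R^nat, conditionally_convergent a ->
    exists2 A, F A & subseries a A @ \oo --> +oo \/ subseries a A @ \oo --> -oo].

Definition nowhere_dense (T : topologicalType) (A : set T) : Prop :=
  (closure A)^° = set0.

Definition meager (T : topologicalType) (A : set T) : Prop :=
  exists2 F : (set T)^nat,
    (forall n, nowhere_dense (F n)) & A = \bigcup_n F n.

Definition meager_cover (T : topologicalType) : set (set (set T)) :=
  [set C | (forall A, C A -> meager A) /\ \bigcup_(A in C) A = [set: T]].

(* A cardinal is represented by a set of that cardinality, and cardinals are
   compared with #<=.  The specifications of the two choices are ss_iP and
   cov_meagerP below. *)
Definition ss_i (R : realType) : set (set nat) := get (min_card (ss_i_family R)).

Definition cov_meager : set (set cantor_space) :=
  get (min_card (@meager_cover cantor_space)).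

Lemma ss_i_family_setT (R : realType) : ss_i_family R [set: set nat].
Proof.
move=> a [cva ncva]; exists [set n | 0 < a n] => //; left.
have sub n : subseries a [set n | 0 < a n] n
    = series (fun k => Num.max (a k) 0) n.
  rewrite /subseries/series/= big_mkcond/=; apply: eq_bigr => k _.
  have -> : (k \in [set n | 0 < a n]) = (0 < a k).
    by apply/idP/idP; rewrite inE.
  by case: ltP.
have nd : nondecreasing_seq (series (fun k => Num.max (a k) 0)).
  by apply: nondecreasing_series => k _ _; rewrite le_max lexx orbT.
rewrite (_ : subseries _ _ = series (fun k => Num.max (a k) 0)); last first.
  exact/funext.
have [bd|nbd] := pselect (has_ubound (range (series (fun k => Num.max (a k) 0)))).
  exfalso; apply: ncva.
  have cvp := nondecreasing_is_cvgn nd bd.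
  rewrite (_ : [normed series a] =
    series (fun k => Num.max (a k) 0) + series (fun k => Num.max (a k) 0)
      - series a).
    by apply: is_cvgB => //; apply: is_cvgD.
  apply/funext => n; rewrite /series/= !fctE/= -big_split/= -sumrB.
  apply: eq_bigr => k _; have [ak|ak] := leP (a k) 0.
    by rewrite ler0_norm// !addr0 sub0r.
  by rewrite gtr0_norm// addrK.
apply/cvgryPge => M.
have [N MN] : exists N, M <= series (fun k => Num.max (a k) 0) N.
  apply: contrapT => H; apply: nbd; exists M => _ [n _ <-].
  by rewrite leNgt; apply/negP => /ltW Mn; apply: H; exists n.
by exists N => // n /= Nn; apply: (le_trans MN); exact: nd.
Qed.

Lemma ss_iP (R : realType) : min_card (ss_i_family R) (ss_i R).
Proof.
have [F FP] := min_card_nonempty (ex_intro _ _ (@ss_i_family_setT R)).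
exact: (getI FP).
Qed.

Lemma meager_cover_singletons : @meager_cover cantor_space [set [set x] | x in setT].
Proof.
split; last by apply/seteqP; split => // x _; exists [set x].
move=> _ [x _ <-]; exists (fun=> [set x]); last first.
  by apply/seteqP; split => [y ->|y [_ _]//]; exists 0%N.
move=> _; rewrite /nowhere_dense.
have cl : closure [set x] = [set x].
  by apply/esym/closure_id/accessible_closed_set1/hausdorff_accessible;
    exact: cantor_space_hausdorff.
rewrite cl; apply/seteqP; split => // y yx.
have := interior_subset yx => /= yE; rewrite {y}yE in yx.
have : limit_point [set: cantor_space] x by rewrite cantor_perfect.2.
by move=> /(_ _ yx)[z [/eqP zx _ /=]].
Qed.

Lemma cov_meagerP : min_card (@meager_cover cantor_space) cov_meager.
Proof.
have [F FP] := min_card_nonempty (ex_intro _ _ meager_cover_singletons).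
exact: (getI FP).
Qed.

(* Main.v *)
Require Import Defs.
From HB Require Import structures.
From mathcomp Require Import all_boot all_order all_algebra.
From mathcomp Require Import all_classical all_reals all_analysis.
From mathcomp Require Import zify.

Set Implicit Arguments.
Unset Strict Implicit.
Unset Printing Implicit Defensive.

Import Order.TTheory GRing.Theory Num.Theory.
Import numFieldNormedType.Exports.

Local Open Scope classical_set_scope.
Local Open Scope ring_scope.

(** Spread the terms of the alternating harmonic series out along the ones of a
    point [x] of the Cantor space, with zeros elsewhere.  If [x] has infinitely
    many ones, the resulting series is conditionally convergent, so some member
    [A] of the given family yields a subseries tending to +oo or -oo.  For a fixed
    [A], the [x] for which this happens form a meager set: if [A] or its
    complement is finite, the subseries converges; otherwise any finite initial
    segment of [x] can be continued by putting the negative terms in [A] and the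
    positive ones outside [A], or vice versa, so that generically the partial
    sums over [A] are infinitely often <= 0 and infinitely often >= 0. *)

(** * Counting the ones of a binary sequence *)

Definition ones (x : nat -> bool) (n : nat) : nat := (\sum_(0 <= i < n) x i)%N.

Lemma onesS (x : nat -> bool) n : ones x n.+1 = (ones x n + x n)%N.
Proof. by rewrite /ones big_nat_recr. Qed.

Lemma eq_ones (x y : nat -> bool) n :
  (forall i, (i < n)%N -> x i = y i) -> ones x n = ones y n.
Proof. by move=> xy; apply: eq_big_nat => i /andP[_ /xy ->]. Qed.

Lemma ones_le (x : nat -> bool) m n : (m <= n)%N -> (ones x m <= ones x n)%N.
Proof.
move=> /subnKC <-; elim: (n - m)%N => [|d IH]; first by rewrite addn0.
by rewrite addnS onesS (leq_trans IH)// leq_addr.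
Qed.

Definition frequently (P : nat -> Prop) : Prop :=
  forall n, exists2 m, (n <= m)%N & P m.

Lemma not_frequently (P : nat -> Prop) :
  ~ frequently P -> exists n, forall m, (n <= m)%N -> ~ P m.
Proof.
move=> /existsNP[n nP]; exists n => m nm Pm.
by apply: nP; exists m.
Qed.

Lemma ones_cvg (x : nat -> bool) : frequently x -> ones x @ \oo --> \oo.
Proof.
move=> fx; apply/cvgnyPge => k.
have [n kn] : exists n, (k <= ones x n)%N.
  elim: k => [|k [n kn]]; first by exists 0%N.
  have [m nm xm] := fx n; exists m.+1.
  by rewrite onesS xm addn1 ltnS (leq_trans kn)// ones_le.
by exists n => // m /= nm; rewrite (leq_trans kn)// ones_le.
Qed.

(** The count of earlier ones satisfies a primitive recursion of its own, so it is built first and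
    the sequence is read off from it. *)
Lemma exists_self_counting (b : nat -> nat -> bool) :
  exists y : nat -> bool, forall n, y n = b n (ones y n).
Proof.
pose fix k n := if n is m.+1 then (k m + b m (k m))%N else 0%N.
exists (fun n => b n (k n)) => n; congr b.
elim: n => [|n IH]; first by rewrite /ones big_nil.
by rewrite onesS -IH.
Qed.

(** * Divergence to infinity and subseries *)

Lemma frequently_not_cvgy (R : realType) (u : R^nat) M :
  frequently (fun n => u n <= M) -> ~ u @ \oo --> +oo.
Proof.
move=> fu /cvgry_gt/(_ M)[n _ un].
by have [m nm] := fu n; rewrite leNgt => /negP; apply; exact: un.
Qed.

Lemma cvgn_not_cvgy (R : realType) (u : R^nat) : cvgn u -> ~ u @ \oo --> +oo.
Proof.
move=> /cvg_ex[l ul]; apply: (@frequently_not_cvgy _ _ (l + 1)) => n.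
have [N _ uN] : \forall m \near \oo, u m <= l + 1.
  by apply: (cvgr_le _ ul); rewrite ltrDl.
by exists (maxn n N); [exact: leq_maxl|apply: uN; exact: leq_maxr].
Qed.

Lemma cvgn_not_cvgNy (R : realType) (u : R^nat) : cvgn u -> ~ u @ \oo --> -oo.
Proof. by move=> /is_cvgN/cvgn_not_cvgy H /cvgNry. Qed.

Section subseries.
Variables (R : realType) (a : R^nat) (A : set nat).

Lemma subseriesS n :
  subseries a A n.+1 = subseries a A n + (if n \in A then a n else 0).
Proof.
by rewrite /subseries/= big_mkcond big_nat_recr//= -big_mkcond.
Qed.

Lemma subseries_setC n :
  subseries a A n + subseries a (~` A) n = series a n.
Proof.
rewrite /subseries/series/= [RHS](bigID (fun k => k \in A))/=.
by congr (_ + _); apply: eq_bigl => k; rewrite in_setC.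
Qed.

Lemma subseries_cvg_finite :
  ~ frequently A -> cvgn (subseries a A).
Proof.
move=> /not_frequently[N AN]; apply/cvg_ex; exists (subseries a A N).
apply: cvg_near_cst; exists N => // m /= /subnKC <-.
elim: (m - N)%N => [|d IH]; first by rewrite addn0.
rewrite addnS subseriesS IH memNset ?addr0//; apply: AN.
exact: leq_addr.
Qed.

End subseries.

Lemma subseries_cvg_cofinite (R : realType) (a : R^nat) (A : set nat) :
  cvgn (series a) -> ~ frequently (~` A) -> cvgn (subseries a A).
Proof.
move=> ca fA; have cA := @subseries_cvg_finite _ a _ fA.
rewrite (_ : subseries a A = series a - subseries a (~` A)).
  exact: is_cvgB.
by apply/funext => n; rewrite !fctE -(subseries_setC a A) addrK.
Qed.

(** * Spreading a series along a binary sequence *)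

(** As [ones x n] counts the ones strictly below [n], the one preceded by exactly [k] others carries
    the term [c k]. *)
Definition spread (R : realType) (c : R^nat) (x : nat -> bool) : R^nat :=
  fun n => if x n then c (ones x n) else 0.

Section spread.
Variables (R : realType) (c : R^nat).
Implicit Types (x y : nat -> bool) (A : set nat).

Lemma series_spread x n : series (spread c x) n = series c (ones x n).
Proof.
rewrite /series/=; elim: n => [|n IH]; first by rewrite /ones !big_nil.
rewrite big_nat_recr//= IH onesS /spread; case: (x n); last by rewrite addn0 addr0.
by rewrite addn1 big_nat_recr.
Qed.

Lemma eq_subseries_spread x y A n : (forall i, (i < n)%N -> x i = y i) ->
  subseries (spread c x) A n = subseries (spread c y) A n.
Proof.
move=> xy; rewrite /subseries/=; apply: congr_big_nat => // i /andP[_ iN] /=.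
rewrite /spread xy// (@eq_ones x y)// => j ji.
by apply: xy; exact: ltn_trans ji iN.
Qed.

Lemma is_cvg_series_spread x :
  cvgn (series c) -> frequently x -> cvgn (series (spread c x)).
Proof.
move=> /cvg_ex[l cl] fx; apply/cvg_ex; exists l.
rewrite (_ : series (spread c x) = series c \o ones x).
  exact: cvg_comp (ones_cvg fx) cl.
by apply/funext => n; rewrite series_spread.
Qed.

End spread.

(** The partial sums, plain and absolute, are those of [c] reindexed by [ones x], which tends to
    infinity. *)
Lemma conditionally_convergent_spread (R : realType) (c : R^nat)
    (x : nat -> bool) : conditionally_convergent c -> frequently x ->
  conditionally_convergent (spread c x).
Proof.
move=> [cc nc] fx; split; first exact: is_cvg_series_spread.
have nd : nondecreasing_seq [normed series c] by apply: nondecreasing_series => n _ _; exact: normr_ge0.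
have cy : [normed series c] @ \oo --> +oo.
  exact: nondecreasing_dvgn_lt.
move=> /cvgn_not_cvgy; apply.
rewrite (_ : [normed series _] = [normed series c] \o ones x).
  exact: cvg_comp (ones_cvg fx) cy.
apply/funext => n /=; rewrite -(series_spread (fun k => `|c k|)).
congr (series _ n); apply/funext => k; rewrite /spread.
by case: (x k); rewrite ?normr0.
Qed.

(** * The alternating harmonic series *)

(** This is 1 - 1 + 1/2 - 1/2 + 1/3 - 1/3 + ...: its even and odd parts are exactly harmonic sums,
    up to sign. *)
Definition alternating_harmonic (R : realType) : R^nat :=
  fun n => (-1) ^+ n * harmonic n./2.

Section alternating_harmonic.
Variable R : realType.
Let c : R^nat := alternating_harmonic R.
Let H : R^nat := series harmonic.

Lemma series_harmonic_cvgy : H @ \oo --> +oo.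
Proof.
apply: nondecreasing_dvgn_lt; last exact: dvg_harmonic.
by apply: nondecreasing_series => n _ _; exact: harmonic_ge0.
Qed.

Lemma half_cvg : half @ \oo --> \oo.
Proof. by apply/cvgnyPge => k; exists k.*2 => // m /= km; lia. Qed.

Lemma uphalf_cvg : uphalf @ \oo --> \oo.
Proof. by apply/cvgnyPge => k; exists k.*2 => // m /= km; lia. Qed.

Let HS n : H n.+1 = H n + harmonic n.
Proof. by rewrite /H/series/= big_nat_recr. Qed.

Lemma sum_odd_alternating_harmonic n :
  \sum_(0 <= i < n | odd i) c i = - H n./2.
Proof.
elim: n => [|n IH]; first by rewrite /H/series/= !big_nil oppr0.
rewrite big_mkcond big_nat_recr//= -big_mkcond IH uphalf_half.
have [on|en] := boolP (odd n); last by rewrite addr0.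
by rewrite add1n HS opprD /c /alternating_harmonic -signr_odd on mulN1r.
Qed.

Lemma sum_even_alternating_harmonic n :
  \sum_(0 <= i < n | ~~ odd i) c i = H (uphalf n).
Proof.
elim: n => [|n IH]; first by rewrite /H/series/= !big_nil.
rewrite big_mkcond big_nat_recr//= -big_mkcond IH uphalf_half.
have [on|en] := boolP (odd n); first by rewrite addr0 add1n.
by rewrite HS /c /alternating_harmonic -signr_odd (negbTE en) mul1r.
Qed.

Lemma alternating_harmonic_conditionally_convergent :
  conditionally_convergent c.
Proof.
split.
  apply/cvg_ex; exists 0.
  apply: (@squeeze_cvgr _ _ _ _ (cst 0) (harmonic \o half)).
  - apply: nearW => n; rewrite /series/= (bigID odd)/=.
    rewrite sum_odd_alternating_harmonic sum_even_alternating_harmonic uphalf_half.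
    case: (odd n); rewrite ?add1n ?add0n ?HS ?addKr ?addNr ?lexx ?andbT;
      exact: harmonic_ge0.
  - exact: cvg_cst.
  - exact: cvg_comp half_cvg cvg_harmonic.
(* The odd terms alone already contribute [H n./2] to the absolute sum. *)
move=> /cvgn_not_cvgy; apply.
have := cvg_comp _ _ half_cvg series_harmonic_cvgy.
apply: ger_cvgy; apply: nearW => n /=.
rewrite -[leLHS]opprK -sum_odd_alternating_harmonic -sumrN big_mkcond.
by apply: ler_sum => i _; case: ifP => _; rewrite // -normrN ler_norm.
Qed.

End alternating_harmonic.

(** * Steering the subseries by extending an initial segment *)

Section steering.
Variables (R : realType) (A : set nat).
Let c : R^nat := alternating_harmonic R.
Hypothesis fA : frequently A.
Hypothesis fNA : frequently (~` A).

(* With [e = true] the odd (negative) terms are placed in [A] and the even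
   (positive) ones outside [A]; with [e = false], conversely. *)
Lemma steer (e : bool) (x : nat -> bool) N : exists y : nat -> bool,
  [/\ forall i, (i < N)%N -> x i = y i, frequently y &
   exists C, forall n, (N <= n)%N -> subseries (spread c y) A n =
     C + \sum_(0 <= i < ones y n | odd i == e) c i].
Proof.
(* From [N] on, a one is placed at [n] exactly when membership of [n] in [A] suits the parity of the
   next term. *)
have [y yE] := exists_self_counting (fun n k =>
  if (n < N)%N then x n else (n \in A) == (odd k == e)).
exists y; split.
- by move=> i iN; rewrite yE iN.
(* Without further ones the parity of the next term is frozen, yet [A] and its complement both offer
   later positions, so one of the required kind occurs. *)
- move=> n; apply: contrapT => nex.
  have y0 m : (maxn n N <= m)%N -> y m = false.
    move=> nm; apply/negP => ym; apply: nex; exists m => //.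
    exact: leq_trans (leq_maxl _ _) nm.
  have k0 m : (maxn n N <= m)%N -> ones y m = ones y (maxn n N).
    move=> /subnKC <-; elim: (m - _)%N => [|d IH]; first by rewrite addn0.
    by rewrite addnS onesS IH y0 ?addn0// leq_addr.
  have [m nm mA] : exists2 m, (maxn n N <= m)%N &
      (m \in A) = (odd (ones y (maxn n N)) == e).
    case: (_ == e).
      by have [m nm mA] := fA (maxn n N); exists m => //; rewrite mem_set.
    by have [m nm mA] := fNA (maxn n N); exists m => //; rewrite memNset.
  have := y0 _ nm; rewrite yE k0// mA eqxx ltnNge.
  by rewrite (leq_trans (leq_maxr _ _) nm).
- exists (subseries (spread c y) A N - \sum_(0 <= i < ones y N | odd i == e) c i).
  move=> n /subnKC <-; elim: (n - N)%N => [|d IH]; first by rewrite addn0 subrK.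
  rewrite addnS subseriesS onesS IH -addrA; congr (_ + _).
  have := yE (N + d)%N; rewrite ltnNge leq_addr/= /spread.
  case: (y (N + d)%N) => /esym/eqP; last by rewrite addn0 if_same addr0.
  by move=> ->; rewrite addn1 [RHS]big_mkcond big_nat_recr//= -big_mkcond.
Qed.

(** The odd terms sum to minus a harmonic sum, which eventually outweighs the constant [C] left by
    the initial segment. *)
Lemma steer_down x N : exists2 y : nat -> bool,
  (forall i, (i < N)%N -> x i = y i) &
  exists2 m, (N <= m)%N & subseries (spread c y) A m <= 0.
Proof.
have [y [xy fy [C yC]]] := steer true x N; exists y => //.
have := cvg_comp _ _ (cvg_comp _ _ (ones_cvg fy) half_cvg) (@series_harmonic_cvgy R).
move=> /cvgry_ge/(_ C)[n _ nC]; exists (maxn n N); first exact: leq_maxr.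
rewrite yC ?leq_maxr//.
under eq_bigl do rewrite eqb_id.
by rewrite sum_odd_alternating_harmonic subr_le0; apply: nC; exact: leq_maxl.
Qed.

Lemma steer_up x N : exists2 y : nat -> bool,
  (forall i, (i < N)%N -> x i = y i) &
  exists2 m, (N <= m)%N & 0 <= subseries (spread c y) A m.
Proof.
have [y [xy fy [C yC]]] := steer false x N; exists y => //.
have := cvg_comp _ _ (cvg_comp _ _ (ones_cvg fy) uphalf_cvg) (@series_harmonic_cvgy R).
move=> /cvgry_ge/(_ (- C))[n _ nC]; exists (maxn n N); first exact: leq_maxr.
rewrite yC ?leq_maxr//.
under eq_bigl do rewrite eqbF_neg.
rewrite sum_even_alternating_harmonic -lerBlDl sub0r; apply: nC; exact: leq_maxl.
Qed.

End steering.

(** * Cylinders and nowhere dense sets in the Cantor space *)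

Definition cylinder (x : cantor_space) (n : nat) : set cantor_space :=
  [set y | forall i, (i < n)%N -> x i = y i].

Lemma cylinder_le x m n : (m <= n)%N -> cylinder x n `<=` cylinder x m.
Proof. by move=> mn y xy i im; apply: xy; exact: leq_trans im mn. Qed.

Lemma nbhs_cylinder x n : nbhs x (cylinder x n).
Proof.
elim: n => [|n IH]; first by apply: filterS filterT => y _ i.
have nx : nbhs x [set y : cantor_space | x n = y n].
  apply: (@proj_continuous nat (fun=> bool) n x [set b | x n = b]).
  by apply: filterS (discrete_set1 _) => b ->.
apply: filterS2 IH nx => y xy yn i; rewrite ltnS leq_eqVlt => /orP[/eqP->//|].
exact: xy.
Qed.

Lemma cylinder_sub_nbhs (x : cantor_space) (O : set cantor_space) :
  nbhs x O -> exists n, cylinder x n `<=` O.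
Proof.
move=> xO; apply: contrapT => nO.
have /choice[y yP] n : exists y, cylinder x n y /\ ~ O y.
  apply: contrapT => H; apply: nO; exists n => y xy.
  by apply: contrapT => Oy; apply: H; exists y.
(* The topology is the supremum of those induced by the coordinates, and coordinate [i] is settled
   from [i.+1] on. *)
have yx : y @ \oo --> x.
  apply/cvg_sup => i U [V] [[W] oW <-] Wx WU.
  apply: (filterS WU); rewrite nbhs_simpl; exists i.+1 => // n /= iN.
  by rewrite -(yP n).1.
by have [n _ /(_ n (leqnn n))] := yx _ xO; exact: (yP n).2.
Qed.

(** Combinatorial form of nowhere density: every finite initial segment extends to one whose
    cylinder misses [K]. *)
Definition avoidable (K : set cantor_space) : Prop :=
  forall x n, exists2 y, cylinder x n y & exists m, cylinder y m `&` K = set0.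

Lemma avoidable_nowhere_dense K : avoidable K -> nowhere_dense K.
Proof.
move=> aK; apply/seteqP; split => // x xK.
have [n xn] := cylinder_sub_nbhs xK.
have [y xy [m ymK]] := aK x n.
have [z [Kz yz]] := xn _ xy _ (nbhs_cylinder y m).
by have : set0 z by rewrite -ymK.
Qed.

Lemma avoidableU K L : avoidable K -> avoidable L -> avoidable (K `|` L).
Proof.
move=> aK aL x n; have [y xy [m ymK]] := aK x n.
have [z yz [p zpL]] := aL y (maxn m n); exists z.
  by move=> i iN; rewrite xy// yz// (leq_trans iN)// leq_maxr.
exists (maxn m p); apply/seteqP; split => // t [zt [Kt|Lt]].
  rewrite -ymK; split => // i im; rewrite yz ?zt//.
    exact: leq_trans im (leq_maxl _ _).
  exact: leq_trans im (leq_maxl _ _).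
by rewrite -zpL; split => //; apply: cylinder_le zt; exact: leq_maxr.
Qed.

(** [meager] asks for equality with the union, so each [F n] is cut down to [K]. *)
Lemma meager_sub_bigcup (T : topologicalType) (K : set T) (F : (set T)^nat) :
  (forall n, nowhere_dense (F n)) -> K `<=` \bigcup_n F n -> meager K.
Proof.
move=> ndF KF; exists (fun n => F n `&` K); last first.
  by apply/seteqP; split=> [x Kx|x [n _ []//]]; have [n _ Fx] := KF x Kx; exists n.
move=> n; apply/seteqP; split => // x; rewrite -(ndF n).
by apply: interiorS; apply: closure_subset; exact: subIsetl.
Qed.

(** * Meagerness of the set attached to each [A] *)

(* The points with finitely many ones are put in every such set, so that these
   sets cover the whole space. *)
Definition unbounded_subseries (R : realType) (A : set nat) : set cantor_space :=
  [set x : cantor_space | frequently x ->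
    let u := subseries (spread (alternating_harmonic R) x) A in
    u @ \oo --> +oo \/ u @ \oo --> -oo].

Lemma avoidable_eventually0 n :
  avoidable [set x | forall m, (n <= m)%N -> x m = false].
Proof.
move=> x N; exists (fun i => if (i < N)%N then x i else true).
  by move=> i /= ->.
exists (maxn n N).+1; apply/seteqP; split => // z [zx /= /(_ (maxn n N))].
by rewrite leq_maxl -zx ?ltnS// ltnNge leq_maxr => /(_ isT).
Qed.

Lemma meager_unbounded_subseries (R : realType) (A : set nat) :
  meager (unbounded_subseries R A).
Proof.
set c := alternating_harmonic R.
pose E n : set cantor_space := [set x | forall m, (n <= m)%N -> x m = false].
have xE (x : cantor_space) : ~ frequently x -> exists n, E n x.
  move=> /not_frequently[n xn]; exists n => m nm.
  by apply/negP; exact: xn.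
have [[fA fNA]|triv] := pselect (frequently A /\ frequently (~` A)); last first.
  apply: (@meager_sub_bigcup _ _ E) => [n|x Mx].
    by apply/avoidable_nowhere_dense/avoidable_eventually0.
  have [fx|/xE[n En]] := pselect (frequently x); last by exists n.
  have cu : cvgn (subseries (spread c x) A).
    have [fA|] := pselect (frequently A); last exact: subseries_cvg_finite.
    apply: subseries_cvg_cofinite; last by move=> ?; apply: triv.
    have [cc _] := alternating_harmonic_conditionally_convergent R.
    exact: is_cvg_series_spread.
  by case: (Mx fx) => [/(cvgn_not_cvgy cu)|/(cvgn_not_cvgNy cu)].
pose P n : set cantor_space :=
  [set x | forall m, (n <= m)%N -> 0 < subseries (spread c x) A m].
pose Q n : set cantor_space :=
  [set x | forall m, (n <= m)%N -> subseries (spread c x) A m < 0].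
(* A subseries tending to an infinity has partial sums of constant strict sign from some [n] on. *)
apply: (@meager_sub_bigcup _ _ (fun n => E n `|` (P n `|` Q n))) => [n|x Mx].
  apply: avoidable_nowhere_dense; apply: avoidableU.
    exact: avoidable_eventually0.
  apply: avoidableU => x N.
    (* Starting at [maxn n N] keeps the first [N] coordinates and gives [m >= n]. The sum at [m]
       depends only on coordinates below [m], so it is nonpositive on all of [cylinder y m]. *)
    have [y xy [m Nm ym]] := @steer_down R A fA fNA x (maxn n N); exists y.
      by apply: cylinder_le xy; exact: leq_maxr.
    exists m; apply/seteqP; split => // z [yz /(_ m)].
    rewrite -(eq_subseries_spread _ _ yz) ltNge ym => /(_ _)/negP; apply => //.
    exact: leq_trans (leq_maxl _ _) Nm.
  have [y xy [m Nm ym]] := @steer_up R A fA fNA x (maxn n N); exists y.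
    by apply: cylinder_le xy; exact: leq_maxr.
  exists m; apply/seteqP; split => // z [yz /(_ m)].
  rewrite -(eq_subseries_spread _ _ yz) ltNge ym => /(_ _)/negP; apply => //.
  exact: leq_trans (leq_maxl _ _) Nm.
have [fx|/xE[n En]] := pselect (frequently x); last by exists n => //; left.
case: (Mx fx) => [/cvgry_gt/(_ 0)[n _ xn]|/cvgrNy_lt/(_ 0)[n _ xn]].
  by exists n => //; right; left => m; exact: xn.
by exists n => //; right; right => m; exact: xn.
Qed.

Lemma meager_cover_unbounded_subseries (R : realType) (F : set (set nat)) :
  ss_i_family R F -> meager_cover (unbounded_subseries R @` F).
Proof.
move=> FP; split; first by move=> _ [A _ <-]; exact: meager_unbounded_subseries.
have cc := alternating_harmonic_conditionally_convergent R.
apply/seteqP; split => // x _.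
have [fx|nfx] := pselect (frequently x).
  have [A FA Ay] := FP _ (conditionally_convergent_spread cc fx).
  by exists (unbounded_subseries R A) => //; exists A.
(* Such an [x] lies in every set of the cover vacuously; only a member of [F] is wanted here. *)
have [A FA _] := FP _ cc.
by exists (unbounded_subseries R A) => //; exists A.
Qed.

(** * Comparison of the cardinals *)

Local Open Scope card_scope.

Theorem theorem15 (R : realType) : cov_meager #<= ss_i R.
Proof.
apply: card_le_trans (card_image_le (unbounded_subseries R) (ss_i R)).
apply: cov_meagerP.2; apply: meager_cover_unbounded_subseries.
exact: (ss_iP R).1.
Qed.
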